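(* Let $T=(T_1,\dots,T_m)$ be a commuting, bounded spherical operator $m$-tuple on an infinite-dimensional Hilbert space $\mathcal H$. Then the following are equivalent: (1) $\ker(D_{T^*})=\bigcap_{i=1}^m\ker T_i^*$ is a one-dimensional subspace which is cyclic for $T$; (2) $T$ is unitarily equivalent to an $m$-variable weighted shift; (3) $T$ is unitarily equivalent to the multiplication $m$-tuple $M_z$ on a space $H^2(\beta)$ for some multi-sequence $\beta$ of positive numbers.
   Context: For $U=(u_{jk})\in\mathcal U(m)$ (unitary $m\times m$ matrices), $T_U$ is the tuple with $(T_U)_j=\sum_k u_{jk}T_k$. $T$ is spherical if for every $U\in\mathcal U(m)$ there is a unitary $\Gamma(U)$ on $\mathcal H$ with $\Gamma(U)T_j=(T_U)_j\Gamma(U)$ for all $j$. A closed subspace $\mathcal M$ is cyclic for $T$ if $\mathcal H$ is the closed linear span of $\{T^nx: x\in\mathcal M, n\in\mathbb N^m\}$, where $T^n=T_1^{n_1}\cdots T_m^{n_m}$. An $m$-variable weighted shift (with positive weights, bounded and commuting) with respect to an orthonormal basis $\{e_n\}_{n\in\mathbb N^m}$ is defined by $T_je_n=w^{(j)}_ne_{n+\epsilon_j}$, $\epsilon_j$ the $j$-th unit multi-index. For a positive multi-sequence $\beta=(\beta_n)_{n\in\mathbb N^m}$, $H^2(\beta)$ is the Hilbert space of formal power series $\sum a_nz^n$ with norm $\sum|a_n|^2\beta_n^2<\infty$, and $M_z=(M_{z_1},\dots,M_{z_m})$ is the (assumed bounded) tuple of multiplications by the coordinate functions. *)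

(* Defs.v *)
From HB Require Import structures.
From mathcomp Require Import all_boot all_order all_algebra spectral.
From mathcomp Require Import complex.
From mathcomp Require Import all_classical all_reals ereal esum.
Set Implicit Arguments. Unset Strict Implicit. Unset Printing Implicit Defensive.
Import Order.TTheory GRing.Theory Num.Theory.
Local Open Scope ring_scope.
Local Open Scope classical_set_scope.

Section InnerProduct.
Variable R : realType.
Local Notation C := R[i].

(* ip is linear in the first argument, conjugate symmetric, positive definite.
   The order on C = R[i] is: 0 <= z  iff  Im z = 0 and 0 <= Re z. *)
Definition inner_product (V : lmodType C) (ip : V -> V -> C) : Prop :=
  [/\ (forall (a : C) (x y z : V), ip (a *: x + y) z = a * ip x z + ip y z),
      (forall x y : V, ip y x = conjc (ip x y)),
      (forall x : V, 0 <= ip x x) &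
      (forall x : V, ip x x = 0 -> x = 0)].

Definition ipnorm (V : lmodType C) (ip : V -> V -> C) (x : V) : R :=
  Num.sqrt (complex.Re (ip x x)).

Definition ip_complete (V : lmodType C) (ip : V -> V -> C) : Prop :=
  forall u : nat -> V,
    (forall e : R, 0 < e -> exists N, forall p q, (N <= p)%N -> (N <= q)%N ->
        ipnorm ip (u p - u q) < e) ->
    exists l : V, forall e : R, 0 < e -> exists N, forall n, (N <= n)%N ->
        ipnorm ip (u n - l) < e.
End InnerProduct.

Record hilbert (R : realType) := Hilbert {
  hcarrier :> lmodType R[i];
  hip : hcarrier -> hcarrier -> R[i];
  hip_inner : inner_product hip;
  hip_complete : ip_complete hip }.

Section Operators.
Variable R : realType.
Local Notation C := R[i].
Variable H : hilbert R.

Definition hnorm (x : H) : R := ipnorm (@hip R H) x.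

Definition is_linear (A : H -> H) : Prop :=
  forall (a : C) (x y : H), A (a *: x + y) = a *: A x + A y.

Definition bounded_op (A : H -> H) : Prop :=
  is_linear A /\ exists M : R, forall x, hnorm (A x) <= M * hnorm x.

Definition in_span (S : set H) (x : H) : Prop :=
  exists n (v : 'I_n -> H) (c : 'I_n -> C),
    (forall i, S (v i)) /\ x = \sum_(i < n) c i *: v i.

Definition spans_densely (S : set H) : Prop :=
  forall (x : H) (e : R), 0 < e ->
    exists y, in_span S y /\ hnorm (x - y) < e.

Definition infinite_dim : Prop :=
  forall n (v : 'I_n -> H), exists x, ~ in_span (range v) x.

Definition unitary_op (G : H -> H) : Prop :=
  [/\ is_linear G, (forall x y, hip (G x) (G y) = hip x y)
    & forall y, exists x, G x = y].

(* kernel of the adjoint A^* : y in ker A^* iff <x, A^* y> = <A x, y> = 0 for all x *)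
Definition ker_adj (A : H -> H) : set H := [set y | forall x, hip (A x) y = 0].

Definition one_dim (S : set H) : Prop :=
  exists e : H, e <> 0 /\ S = [set a *: e | a in [set: C]].

Variable m : nat.

Definition bc_tuple (T : 'I_m -> H -> H) : Prop :=
  (forall j, bounded_op (T j)) /\ (forall i j x, T i (T j x) = T j (T i x)).

Definition rot_tuple (T : 'I_m -> H -> H) (U : 'M[C]_m) : 'I_m -> H -> H :=
  fun j x => \sum_(k < m) U j k *: T k x.

Definition spherical (T : 'I_m -> H -> H) : Prop :=
  forall U : 'M[C]_m, U \is unitarymx ->
    exists G, unitary_op G /\ forall j x, G (T j x) = rot_tuple T U j (G x).

Definition defect_ker (T : 'I_m -> H -> H) : set H :=
  [set y | forall i, ker_adj (T i) y].

End Operators.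

Definition mindex (m : nat) := {ffun 'I_m -> nat}.
Definition addeps m (n : mindex m) (j : 'I_m) : mindex m :=
  [ffun i => (n i + (i == j))%N].
Definition subeps m (n : mindex m) (j : 'I_m) : mindex m :=
  [ffun i => (n i - (i == j))%N].

Section Tuples.
Variable R : realType.
Local Notation C := R[i].

Definition mpow (H : hilbert R) m (T : 'I_m -> H -> H) (n : mindex m) (x : H) : H :=
  foldr (fun i y => iter (n i) (T i) y) x (enum 'I_m).

Definition cyclic_for (H : hilbert R) m (T : 'I_m -> H -> H) (M : set H) : Prop :=
  spans_densely [set y | exists n x, M x /\ y = mpow T n x].

Definition orthonormal_basis (H : hilbert R) m (e : mindex m -> H) : Prop :=
  (forall n k, hip (e n) (e k) = (n == k)%:R) /\ spans_densely (range e).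

(* S is an m-variable weighted shift (positive weights) w.r.t. some ONB;
   boundedness and commutativity are required separately (bc_tuple). *)
Definition weighted_shift (H : hilbert R) m (S : 'I_m -> H -> H) : Prop :=
  exists (e : mindex m -> H) (w : 'I_m -> mindex m -> R),
    [/\ orthonormal_basis e, (forall j n, 0 < w j n)
      & forall j n, S j (e n) = (w j n)%:C%C *: e (addeps n j)].

Definition unit_equiv (H K : hilbert R) m (T : 'I_m -> H -> H) (S : 'I_m -> K -> K) : Prop :=
  exists V : H -> K,
    [/\ forall (a : C) (x y : H), V (a *: x + y) = a *: V x + V y,
        forall x y, hip (V x) (V y) = hip x y,
        forall z, exists x, V x = z
      & forall j x, V (T j x) = S j (V x)].

Definition cabs2 (z : C) : R := complex.Re z ^+ 2 + complex.Im z ^+ 2.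

Definition h2norm2 m (beta : mindex m -> R) (a : mindex m -> C) : \bar R :=
  \esum_(n in [set: mindex m]) (cabs2 (a n) * beta n ^+ 2)%:E.

Definition in_H2 m (beta : mindex m -> R) (a : mindex m -> C) : Prop :=
  (h2norm2 beta a < +oo)%E.

(* multiplication by z_j on formal power series *)
Definition Mz m (j : 'I_m) (a : mindex m -> C) : mindex m -> C :=
  fun n => if (0 < n j)%N then a (subeps n j) else 0.

Definition Mz_bounded m (beta : mindex m -> R) : Prop :=
  forall j : 'I_m, exists M : R, forall a, in_H2 beta a ->
    (h2norm2 beta (Mz j a) <= M%:E * h2norm2 beta a)%E.

Definition unit_equiv_Mz (H : hilbert R) m (T : 'I_m -> H -> H)
    (beta : mindex m -> R) : Prop :=
  exists V : H -> (mindex m -> C),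
    [/\ forall (c : C) (x y : H), V (c *: x + y) = (fun n => c * V x n + V y n),
        forall x, in_H2 beta (V x),
        forall a, in_H2 beta a -> exists x, V x = a,
        forall x, (complex.Re (hip x x))%:E = h2norm2 beta (V x)
      & forall j x, V (T j x) = Mz j (V x)].
End Tuples.

(* Main.v *)
(** Let e span ker D_{T^*}.  The unitaries Gamma(U) preserve this kernel, so e is
    an eigenvector of all of them.  Diagonal U make the vectors T^n e pairwise
    orthogonal.  They do not vanish: expanding Gamma(U) T^n e over words, for a U
    whose j-th row and column are positive, shows that if one word of length N
    kills e, then so do T_j^N and hence all words of length N; the space would be
    spanned by finitely many T^n e.  Normalising T^n e gives an orthonormal basis
    on which T is a weighted shift.  With beta_n = |T^n e_0|, the expansion
    x |-> <x, e_n> / beta_n carries a weighted shift to M_z (Parseval and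
    Riesz-Fischer), and conversely the monomials z^n / beta_n form a basis for
    which M_z is a weighted shift.  For a weighted shift the joint kernel of the
    adjoints is the line through e_0, and the T^n e_0 are multiples of the e_n. *)

Require Import Defs.
From HB Require Import structures.
From mathcomp Require Import all_boot all_order all_algebra spectral finmap.
From mathcomp Require Import complex ring lra.
From mathcomp Require Import all_classical all_reals ereal esum.
Set Implicit Arguments. Unset Strict Implicit. Unset Printing Implicit Defensive.
Import Order.TTheory GRing.Theory Num.Theory.
Local Open Scope ring_scope.
Local Open Scope classical_set_scope.

(** * Inner product calculus, Cauchy-Schwarz and density arguments *)

Section HilbertSpace.
Variables (R : realType) (H : hilbert R).
Local Notation C := R[i].
Implicit Types (x y z : H) (a b c : C).

Lemma hip_linear_l a x y z : hip (a *: x + y) z = a * hip x z + hip y z.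
Proof. by case: (hip_inner H) => h _ _ _; apply: h. Qed.

Lemma hip_conj x y : hip y x = conjc (hip x y).
Proof. by case: (hip_inner H) => _ h _ _; apply: h. Qed.

Lemma hip_ge0 x : 0 <= hip x x.
Proof. by case: (hip_inner H) => _ _ h _; apply: h. Qed.

Lemma hip_eq0 x : hip x x = 0 -> x = 0.
Proof. by case: (hip_inner H) => _ _ _ h; apply: h. Qed.

Lemma hip0l z : hip (0 : H) z = 0.
Proof. by have := hip_linear_l (-1) 0 0 z; rewrite scaler0 addr0 mulN1r addNr. Qed.

Lemma hipDl x y z : hip (x + y) z = hip x z + hip y z.
Proof. by rewrite -[x in LHS]scale1r hip_linear_l mul1r. Qed.

Lemma hipZl a x z : hip (a *: x) z = a * hip x z.
Proof. by rewrite -[X in hip X z]addr0 hip_linear_l hip0l addr0. Qed.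

Lemma hipNl x z : hip (- x) z = - hip x z.
Proof. by rewrite -scaleN1r hipZl mulN1r. Qed.

Lemma hipBl x y z : hip (x - y) z = hip x z - hip y z.
Proof. by rewrite hipDl hipNl. Qed.

Lemma hip0r z : hip z (0 : H) = 0.
Proof. by rewrite hip_conj hip0l conjc0. Qed.

Lemma hipDr x y z : hip z (x + y) = hip z x + hip z y.
Proof. by rewrite hip_conj hipDl rmorphD /= -!hip_conj. Qed.

Lemma hipZr a x z : hip z (a *: x) = conjc a * hip z x.
Proof. by rewrite hip_conj hipZl rmorphM /= -!hip_conj. Qed.

Lemma hipNr x z : hip z (- x) = - hip z x.
Proof. by rewrite hip_conj hipNl rmorphN /= -!hip_conj. Qed.

Lemma hipBr x y z : hip z (x - y) = hip z x - hip z y.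
Proof. by rewrite hipDr hipNr. Qed.

Lemma hip_suml I (r : seq I) (P : pred I) (F : I -> H) z :
  hip (\sum_(i <- r | P i) F i) z = \sum_(i <- r | P i) hip (F i) z.
Proof. by elim/big_rec2: _ => [|i y1 y2 _ <-]; rewrite ?hip0l ?hipDl. Qed.

Lemma hip_sumr I (r : seq I) (P : pred I) (F : I -> H) z :
  hip z (\sum_(i <- r | P i) F i) = \sum_(i <- r | P i) hip z (F i).
Proof. by elim/big_rec2: _ => [|i y1 y2 _ <-]; rewrite ?hip0r ?hipDr. Qed.

(** The squared norm as a real number: Pythagorean identities stay free of square roots, and this is
    the quantity that [unit_equiv_Mz] equates with [h2norm2]. *)
Definition nsq x : R := complex.Re (hip x x).

Lemma hip_nsq x : hip x x = (nsq x)%:C%C.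
Proof. by rewrite /nsq RRe_real // ger0_real // hip_ge0. Qed.

Lemma nsq_ge0 x : 0 <= nsq x.
Proof. by rewrite -ler0c -hip_nsq hip_ge0. Qed.

Lemma nsq_eq0 x : nsq x = 0 -> x = 0.
Proof. by move=> h; apply: hip_eq0; rewrite hip_nsq h. Qed.

Lemma nsq_gt0 x : x <> 0 -> 0 < nsq x.
Proof.
by move=> x0; rewrite lt0r nsq_ge0 andbT; apply/eqP => /nsq_eq0.
Qed.

Lemma hnorm_sqr x : hnorm x ^+ 2 = nsq x.
Proof. by rewrite /hnorm /ipnorm sqr_sqrtr // nsq_ge0. Qed.

Lemma hnorm_ge0 x : 0 <= hnorm x.
Proof. exact: sqrtr_ge0. Qed.

Lemma hnorm_gt0 x : x <> 0 -> 0 < hnorm x.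
Proof. by move=> x0; rewrite /hnorm /ipnorm sqrtr_gt0 nsq_gt0. Qed.

Lemma cabs2_norm (z : C) : (cabs2 z)%:C%C = `|z| ^+ 2.
Proof. exact: add_Re2_Im2. Qed.

Lemma cabs2_ge0 (z : C) : 0 <= cabs2 z.
Proof. by rewrite addr_ge0 // sqr_ge0. Qed.

Lemma cabs2_conj (z : C) : (cabs2 z)%:C%C = z * conjc z.
Proof. by rewrite cabs2_norm sqr_normc. Qed.

Lemma cabs2M (z t : C) : cabs2 (z * t) = cabs2 z * cabs2 t.
Proof.
by apply: complexI; rewrite rmorphM /= !cabs2_norm normrM exprMn.
Qed.

Lemma cabs2_real (r : R) : cabs2 r%:C%C = r ^+ 2.
Proof. by rewrite /cabs2 /= expr0n addr0. Qed.

Lemma cabs2_0 : cabs2 (0 : C) = 0.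
Proof. by rewrite /cabs2 /= !expr0n addr0. Qed.

Lemma cabs2_eq0 (z : C) : cabs2 z = 0 -> z = 0.
Proof.
move=> h; apply/eqP; have : `|z| ^+ 2 == 0 by rewrite -cabs2_norm h.
by rewrite expf_eq0 normr_eq0.
Qed.

Lemma nsqZ a x : nsq (a *: x) = cabs2 a * nsq x.
Proof.
by apply: complexI; rewrite -hip_nsq hipZl hipZr hip_nsq rmorphM /= cabs2_conj mulrA.
Qed.

Lemma nsqN x : nsq (- x) = nsq x.
Proof. by rewrite /nsq hipNl hipNr opprK. Qed.

Lemma nsqD x y : nsq (x + y) = nsq x + nsq y + complex.Re (hip x y) *+ 2.
Proof.
rewrite /nsq !hipDl !hipDr !raddfD /= (hip_conj x y).
rewrite mulr2n; case: (hip x y) => r s /=.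
by rewrite -!addrA; congr (_ + _); rewrite [RHS]addrC -!addrA.
Qed.

Lemma nsqD_orth x y : hip x y = 0 -> nsq (x + y) = nsq x + nsq y.
Proof. by move=> h; rewrite nsqD h mul0rn addr0. Qed.

(** Pythagoras for the splitting of [x] into its projection [a *: y] on the line of [y] and the
    orthogonal remainder. *)
Lemma cauchy_schwarz x y : cabs2 (hip x y) <= nsq x * nsq y.
Proof.
have [->|y0] := pselect (y = 0).
  by rewrite hip0r cabs2_0 mulr_ge0 // nsq_ge0.
have ny := nsq_gt0 y0; set a := hip x y / hip y y.
have hyy : hip y y != 0 by rewrite hip_nsq; apply/eqP => /complexI h; rewrite h ltxx in ny.
have o : hip (x - a *: y) (a *: y) = 0.
  by rewrite hipZr hipBl hipZl /a divfK // subrr mulr0.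
have := nsqD_orth o; rewrite subrK nsqZ => hx.
have : cabs2 a * nsq y <= nsq x by rewrite hx lerDr nsq_ge0.
rewrite -(ler_pM2r ny); apply: le_trans.
rewrite -mulrA -expr2 -cabs2_real -cabs2M -hip_nsq /a divfK //.
Qed.

Lemma cauchy_schwarz_norm x y : `|hip x y| <= (hnorm x * hnorm y)%:C%C.
Proof.
rewrite -(@ler_pXn2r _ 2) ?nnegrE ?normr_ge0 ?ler0c ?mulr_ge0 ?hnorm_ge0 //.
by rewrite -cabs2_norm -rmorphXn /= lecR exprMn !hnorm_sqr cauchy_schwarz.
Qed.

Lemma linear_sum (f : H -> C) (n : nat) (v : 'I_n -> H) (c : 'I_n -> C) :
  (forall a x y, f (a *: x + y) = a * f x + f y) ->
  f (\sum_(i < n) c i *: v i) = \sum_(i < n) c i * f (v i).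
Proof.
move=> lf; have f0 : f 0 = 0 by have := lf (-1) 0 0; rewrite scaler0 addr0 mulN1r addNr.
by elim/big_rec2: _ => [|i y1 y2 _ <-]; rewrite ?lf.
Qed.

(** [f] kills the span of [S], so [f x = f (x - y)] for approximants [y] in the span, which is
    arbitrarily small. This carries identities from a basis to the whole space. *)
Lemma bounded_functional_eq0 (S : set H) (f : H -> C) (M : R) :
  spans_densely S -> (forall a x y, f (a *: x + y) = a * f x + f y) ->
  (forall x, `|f x| <= (M * hnorm x)%:C%C) -> (forall x, S x -> f x = 0) ->
  forall x, f x = 0.
Proof.
move=> dS lf bf f0 x; apply/eqP; rewrite -normr_eq0; apply/eqP/le_anti.
rewrite normr_ge0 andbT.
have key e : 0 < e -> `|f x| <= (`|M| * e)%:C%C.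
  move=> e0; have [y [[n [v [c [Sv ey]]]] xy]] := dS x e e0.
  have fy : f y = 0 by rewrite ey (linear_sum _ _ lf) big1 // => i _; rewrite f0 ?mulr0.
  have -> : f x = f (x - y).
    by rewrite -[x in LHS](subrK y) -[x - y in LHS]scale1r lf mul1r fy addr0.
  apply: le_trans (bf _) _; rewrite lecR.
  apply: le_trans (ler_norm _) _; rewrite normrM ler_wpM2l //.
  by rewrite ger0_norm ?hnorm_ge0 // ltW.
rewrite normc_def lecR.
apply/ler_addgt0Pl => e e0; rewrite addr0.
(* Adding 1 keeps the denominator positive when [M = 0]. *)
have d0 : 0 < e / (`|M| + 1) by rewrite divr_gt0 // ltr_wpDl.
have := key _ d0; rewrite normc_def lecR => /le_trans; apply.
by rewrite mulrA ler_pdivrMr ?ltr_wpDl // mulrC ler_pM2l // lerDl.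
Qed.

(** The functional [hip ^~ x] is bounded and vanishes on [S], hence also at [x] itself. *)
Lemma orthogonal_dense_eq0 (S : set H) x :
  spans_densely S -> (forall y, S y -> hip y x = 0) -> x = 0.
Proof.
move=> dS h; apply: hip_eq0; move: {1}x.
apply: (@bounded_functional_eq0 S (fun y => hip y x) (hnorm x)) => //.
- by move=> a y z; rewrite hip_linear_l.
- by move=> y; rewrite mulrC cauchy_schwarz_norm.
Qed.

End HilbertSpace.

(** * Multi-indices and words in the coordinates *)

Section MultiIndices.
Variable m : nat.
Implicit Types (n k : mindex m) (i j : 'I_m) (s : seq 'I_m).

Definition mindex0 : mindex m := [ffun => 0%N].

(** Words are products of the [T j] before commutativity is used; [content] abelianises a word and
    [word] picks one representative for each multi-index. *)
Definition content s : mindex m := [ffun i => count_mem i s].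

Definition word n : seq 'I_m := flatten [seq nseq (n i) i | i <- enum 'I_m].

Lemma content_nil : content [::] = mindex0.
Proof. by apply/ffunP => i; rewrite !ffunE. Qed.

Lemma content_cons j s : content (j :: s) = addeps (content s) j.
Proof. by apply/ffunP => i; rewrite !ffunE /= addnC eq_sym. Qed.

Lemma content_word n : content (word n) = n.
Proof.
apply/ffunP => i; rewrite ffunE count_flatten -map_comp sumnE big_map big_enum /=.
rewrite (bigD1 i) //= count_nseq /= eqxx mul1n big1 ?addn0 // => j ji.
by rewrite count_nseq /= (negPf ji).
Qed.

Lemma perm_word_content s : perm_eq (word (content s)) s.
Proof.
apply/allP => i _ /=; apply/eqP.
by have /ffunP/(_ i) := content_word (content s); rewrite !ffunE.
Qed.

Lemma addepsK n j : subeps (addeps n j) j = n.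
Proof. by apply/ffunP => i; rewrite !ffunE addnK. Qed.

Lemma subepsK n j : (0 < n j)%N -> addeps (subeps n j) j = n.
Proof.
move=> nj; apply/ffunP => i; rewrite !ffunE subnK //.
by case: eqP => // ->.
Qed.

Lemma addeps_gt0 n j : (0 < addeps n j j)%N.
Proof. by rewrite ffunE eqxx addn1. Qed.

Lemma mindex_neq0 n : n != mindex0 -> exists j, (0 < n j)%N.
Proof.
move=> n0; apply/existsP; apply: contraNT n0; rewrite negb_exists => /forallP h.
by apply/eqP/ffunP => i; rewrite ffunE; apply/eqP; have := h i; rewrite -leqNgt leqn0.
Qed.

End MultiIndices.

(** * Products of a commuting tuple along words *)

Section Words.
Variables (R : realType) (H : hilbert R) (m : nat) (T : 'I_m -> H -> H).
Local Notation C := R[i].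
Hypothesis bcT : bc_tuple T.

Lemma bc_linear j (a : C) (x y : H) : T j (a *: x + y) = a *: T j x + T j y.
Proof. by case: bcT => /(_ j)[h _] _; apply: h. Qed.

Lemma bc_comm i j x : T i (T j x) = T j (T i x).
Proof. by case: bcT. Qed.

Lemma bc0 j : T j 0 = 0.
Proof. by have := bc_linear j (-1) 0 0; rewrite scaler0 addr0 scaleN1r addNr. Qed.

Lemma bcZ j (a : C) (x : H) : T j (a *: x) = a *: T j x.
Proof. by have := bc_linear j a x 0; rewrite bc0 !addr0. Qed.

Lemma bcD j (x y : H) : T j (x + y) = T j x + T j y.
Proof. by have := bc_linear j 1 x y; rewrite !scale1r. Qed.

Lemma bc_sum j I (r : seq I) (P : pred I) (F : I -> H) :
  T j (\sum_(i <- r | P i) F i) = \sum_(i <- r | P i) T j (F i).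
Proof. by elim/big_rec2: _ => [|i y1 y2 _ <-]; rewrite ?bc0 ?bcD. Qed.

Lemma bc_hnorm j : exists2 M, 0 <= M & forall x, hnorm (T j x) <= M * hnorm x.
Proof.
case: bcT => /(_ j)[_ [M hM]] _; exists `|M| => // x.
by apply: le_trans (hM x) _; rewrite ler_wpM2r ?hnorm_ge0 ?ler_norm.
Qed.

Lemma foldrZ s (a : C) (x : H) : foldr T (a *: x) s = a *: foldr T x s.
Proof. by elim: s => //= j s ->; rewrite bcZ. Qed.

Lemma foldr0 s : foldr T 0 s = 0.
Proof. by elim: s => //= j s ->; rewrite bc0. Qed.

Lemma mpow_word n x : mpow T n x = foldr T x (word n).
Proof.
rewrite /mpow /word; elim: (enum 'I_m) => //= i r ->.
by rewrite foldr_cat; elim: (n i) => //= k ->.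
Qed.

(** Commutativity pulls any letter of a word to the front, so the first letter of [s] can be
    stripped from both words. *)
Lemma foldr_perm_eq s t x : perm_eq s t -> foldr T x s = foldr T x t.
Proof.
have rem_eq i r : i \in r -> foldr T x r = T i (foldr T x (rem i r)).
  elim: r => //= j r IH; rewrite inE => /orP[/eqP->|ir]; first by rewrite eqxx.
  by case: eqP => [->//|_] /=; rewrite IH // bc_comm.
elim: s t => [|i s IH] t st.
  by move: st; rewrite perm_sym => /perm_nilP->.
have it : i \in t by rewrite -(perm_mem st) mem_head.
rewrite (rem_eq i t) //=; congr (T i _); apply: IH.
by rewrite -(perm_cons i) (perm_trans st) ?perm_to_rem.
Qed.

Lemma foldr_mpow s x : foldr T x s = mpow T (content s) x.
Proof. by rewrite mpow_word; apply/esym/foldr_perm_eq/perm_word_content. Qed.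

Lemma mpow_addeps n j x : mpow T (addeps n j) x = T j (mpow T n x).
Proof. by rewrite -{1}(content_word n) -content_cons -foldr_mpow mpow_word. Qed.

Lemma mpowZ n (a : C) x : mpow T n (a *: x) = a *: mpow T n x.
Proof. by rewrite !mpow_word foldrZ. Qed.

End Words.

(** * The joint kernel of the adjoints of a weighted shift *)

Section WeightedShiftKernel.
Variables (R : realType) (H : hilbert R) (m : nat) (T : 'I_m -> H -> H).
Local Notation C := R[i].
Hypothesis bcT : bc_tuple T.
Variables (e : mindex m -> H) (w : 'I_m -> mindex m -> R).
Hypothesis onb : orthonormal_basis e.
Hypothesis w_gt0 : forall j n, 0 < w j n.
Hypothesis Te : forall j n, T j (e n) = (w j n)%:C%C *: e (addeps n j).

Lemma onb_hip n k : hip (e n) (e k) = (n == k)%:R.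
Proof. by case: onb. Qed.

Lemma onb_dense : spans_densely (range e).
Proof. by case: onb. Qed.

Lemma onb_eq0 x : (forall n, hip (e n) x = 0) -> x = 0.
Proof.
move=> h; apply: (@orthogonal_dense_eq0 _ _ (range e)) onb_dense _.
by move=> _ [n _ <-].
Qed.

Lemma onb_neq0 n : e n <> 0.
Proof.
move=> h; have := onb_hip n n; rewrite h hip0l eqxx => /esym/eqP.
by rewrite oner_eq0.
Qed.

(** The adjoint of [T j] is the backward weighted shift, stated without forming the adjoint. Both
    sides are bounded functionals of [x] that agree on the basis. *)
Lemma shift_hip j x n :
  hip (T j x) (e n) =
  if (0 < n j)%N then (w j (subeps n j))%:C%C * hip x (e (subeps n j)) else 0.
Proof.
pose g : H -> C := fun y => if (0 < n j)%N
  then (w j (subeps n j))%:C%C * hip y (e (subeps n j)) else 0.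
have [M M0 hM] := bc_hnorm bcT j.
apply/eqP; rewrite -subr_eq0; apply/eqP; move: x.
pose f y := hip (T j y) (e n) - g y.
suff: forall x, f x = 0 by [].
apply: (@bounded_functional_eq0 _ _ (range e) f
  (M * hnorm (e n) + w j (subeps n j) * hnorm (e (subeps n j)))) onb_dense _ _ _.
- move=> a x y; rewrite /f /g (bc_linear bcT) !hip_linear_l.
  case: ifP => _; first by rewrite mulrDr mulrBr mulrCA opprD addrACA.
  by rewrite !subr0.
- move=> x; rewrite /f mulrDl rmorphD /=; apply: le_trans (ler_normB _ _) _.
  apply: lerD.
    apply: le_trans (cauchy_schwarz_norm _ _) _; rewrite lecR mulrAC.
    by rewrite ler_wpM2r ?hnorm_ge0.
  have w0 : 0 <= (w j (subeps n j))%:C%C :> C by rewrite ler0c ltW.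
  rewrite /g; case: ifP => _; last first.
    by rewrite normr0 ler0c !mulr_ge0 ?hnorm_ge0 ?ltW.
  rewrite normrM ger0_norm // -mulrA rmorphM /= ler_wpM2l //.
  by rewrite [hnorm (e _) * _]mulrC cauchy_schwarz_norm.
- move=> _ [k _ <-]; rewrite /f /g Te hipZl !onb_hip.
  case: ifP => [nj|/negbT nj].
    have [->|kn] := eqVneq k (subeps n j); first by rewrite subepsK // eqxx subrr.
    rewrite (_ : _ == n = false) ?mulr0 ?subr0 //.
    by apply: contraNF kn => /eqP <-; rewrite addepsK.
  rewrite (_ : _ == n = false) ?mulr0 ?subr0 //.
  by apply: contraNF nj => /eqP <-; rewrite addeps_gt0.
Qed.

(** [c] is the product of the weights along the lattice path from 0 to [n] spelled by [word n]. *)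
Lemma shift_mpow n :
  exists2 c : R, 0 < c & mpow T n (e (mindex0 m)) = c%:C%C *: e n.
Proof.
rewrite mpow_word; have -> : e n = e (content (word n)) by rewrite content_word.
elim: (word n) => [|j s [c c0 IH]].
  by exists 1; rewrite // content_nil scale1r.
exists (c * w j (content s)); first by rewrite mulr_gt0.
by rewrite /= IH (bcZ bcT) Te scalerA -rmorphM content_cons.
Qed.

(** If [n j > 0], then [e n] is a nonzero multiple of a vector in the range of [T j], so a kernel
    vector has no coefficient at [n]; only the one at 0 survives. Conversely, by [shift_hip] every
    range is orthogonal to [e (mindex0 m)]. *)
Lemma shift_defect_ker :
  defect_ker T = [set a *: e (mindex0 m) | a in [set: C]].
Proof.
apply/seteqP; split => [y Dy|_ [a _ <-] j x]; last first.
  by rewrite hipZr shift_hip ffunE mulr0.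
exists (hip y (e (mindex0 m))) => //; apply/eqP; rewrite -subr_eq0; apply/eqP.
apply: onb_eq0 => n; rewrite hipBr hipZr onb_hip -hip_conj.
have [->|/mindex_neq0 [j nj]] := eqVneq n (mindex0 m); first by rewrite mulr1 subrr.
rewrite mulr0 sub0r; apply/eqP; rewrite oppr_eq0; apply/eqP.
have := Dy j (e (subeps n j)); rewrite Te subepsK // hipZl => /eqP.
by rewrite mulf_eq0 => /orP[/eqP /complexI h|/eqP//]; have := w_gt0 j (subeps n j); rewrite h ltxx.
Qed.

Lemma shift_cyclic_defect_ker :
  one_dim (defect_ker T) /\ cyclic_for T (defect_ker T).
Proof.
split; first by exists (e (mindex0 m)); split; [exact: onb_neq0|exact: shift_defect_ker].
move=> x d d0; have [y [[n [v [c [ve ->]]]] xy]] := onb_dense x d0.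
exists (\sum_(i < n) c i *: v i); split => //.
exists n, v, c; split => // i; have [k _ <-] := ve i.
have [r r0 hr] := shift_mpow k.
exists k, (r^-1%:C%C *: e (mindex0 m)); split.
  by rewrite shift_defect_ker; exists r^-1%:C%C.
by rewrite (mpowZ bcT) hr scalerA -rmorphM /= mulVf ?gt_eqF // scale1r.
Qed.

End WeightedShiftKernel.

(** * Unitary matrices used to rotate the tuple *)

Section UnitaryMatrices.
Variable R : realType.
Local Notation C := R[i].

Lemma diag_unitarymx m (d : 'I_m -> C) :
  (forall i, `|d i| = 1) -> diag_mx (\row_i d i) \is unitarymx.
Proof.
move=> d1; apply/unitarymxP/matrixP => i k.
rewrite mul_diag_mx !mxE eq_sym; case: eqP => [->|_]; last first.
  by rewrite mulr0n conjC0 mulr0.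
by rewrite mulr1n -normCK d1 expr1n.
Qed.

Lemma unitarymx_col m (U : 'M[C]_m) k l : U \is unitarymx ->
  \sum_j conjc (U j k) * U j l = (k == l)%:R.
Proof.
rewrite -trmx_unitary => /unitarymxP/matrixP/(_ l k); rewrite !mxE eq_sym => <-.
by apply: eq_bigr => j _; rewrite !mxE mulrC.
Qed.

(* The reflection 2 v v^T / |v|^2 - 1 with v = (m, 1, ..., 1), the entry m being at j0. *)
Lemma unitarymx_positive_cross m (j0 : 'I_m) :
  exists2 U : 'M[C]_m, U \is unitarymx &
    forall k, 0 < U j0 k /\ 0 < U k j0.
Proof.
pose v i : R := if i == j0 then m%:R else 1.
have m0 : (0 < m)%N by apply: leq_ltn_trans (ltn_ord j0).
have v0 i : 0 < v i by rewrite /v; case: ifP => // _; rewrite ltr0n.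
pose s := \sum_i v i ^+ 2.
have sE : s = m%:R ^+ 2 + (m.-1)%:R.
  rewrite /s (bigD1 j0) //= {1}/v eqxx; congr (_ + _).
  rewrite (eq_bigr (fun=> 1)) => [|i /negPf ij]; last by rewrite /v ij expr1n.
  by rewrite sumr_const cardC1 card_ord.
have s0 : 0 < s by rewrite sE ltr_pwDl // exprn_gt0 // ltr0n.
have sN0 : s != 0 by rewrite gt_eqF.
pose u i k : R := 2 * v i * v k / s - (i == k)%:R.
have uC i k : u i k = u k i by rewrite /u [2 * v i * v k]mulrAC eq_sym.
(* As [v v^T] squares to [s] times itself, the symmetric matrix [u] squares to the identity. *)
have uu i k : \sum_l u i l * u k l = (i == k)%:R.
  have E l : u i l * u k l = (4 * v i * v k / s ^+ 2) * v l ^+ 2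
       - 2 * v k / s * (v l * (l == i)%:R) - 2 * v i / s * (v l * (l == k)%:R)
       + (i == l)%:R * (k == l)%:R.
    rewrite /u [l == i]eq_sym [l == k]eq_sym.
    by case: (i == l); case: (k == l) => /=; field.
  have S1 (a : 'I_m -> R) j : \sum_l (a l * (l == j)%:R) = a j.
    rewrite (bigD1 j) //= eqxx mulr1 big1 ?addr0 // => l /negPf->.
    by rewrite mulr0.
  rewrite (eq_bigr _ (fun l _ => E l)) !big_split /= !sumrN -!mulr_sumr !S1 -/s.
  have -> : \sum_l (i == l)%:R * (k == l)%:R = (i == k)%:R :> R.
    by rewrite -[RHS](S1 (fun l => (i == l)%:R)); apply: eq_bigr => l _; rewrite [l == k]eq_sym.
  by field.
have up k : 0 < u j0 k.
  rewrite /u subr_gt0; have [<-|] := eqVneq j0 k; last first.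
    by move=> _; rewrite divr_gt0 // !mulr_gt0.
  (* On the diagonal the claim is [s < 2 m^2], that is [m - 1 < m^2]; this is why [v] has the large
     entry [m] at [j0]. *)
  rewrite ltr_pdivlMr // mul1r sE {1 2}/v eqxx -mulrA -expr2 mulr_natl mulr2n ltrD2l.
  by rewrite -natrX ltr_nat prednK // -mulnn leq_pmulr.
exists (\matrix_(i, k) (u i k)%:C%C); last first.
  by move=> k; rewrite !mxE !ltcR [u k j0]uC up.
apply/unitarymxP/matrixP => i k; rewrite !mxE.
rewrite (eq_bigr (fun l => (u i l * u k l)%:C%C)) => [|l _].
  by rewrite -rmorph_sum uu rmorph_nat.
by rewrite !mxE rmorphM /=; congr (_ * _); apply: conjc_real.
Qed.

End UnitaryMatrices.

(** * Enumeration of the words of a given length *)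

Section AllWords.
Variable m : nat.

Fixpoint all_words N : seq (seq 'I_m) :=
  if N is N'.+1 then [seq k :: t | k <- enum 'I_m, t <- all_words N'] else [:: [::]].

Lemma mem_all_words N t : (t \in all_words N) = (size t == N).
Proof.
elim: N t => [|N IH] t; first by rewrite inE; case: t.
apply/allpairsP/eqP => [[[k s] [_ /= hs ->]]|] /=.
  by move: hs; rewrite IH => /eqP->.
case: t => //= k s [hs]; exists (k, s); split => //=; first by rewrite mem_enum.
by rewrite IH hs.
Qed.

Lemma mem_content_nseq (j : 'I_m) N t :
  content t = content (nseq N j) -> forall i, i \in t -> i = j.
Proof.
move=> /ffunP h i it; have := h i; rewrite !ffunE count_nseq /=.
by case: eqP => // _; rewrite mul0n => /count_memPn; rewrite it.
Qed.

End AllWords.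

(** * Orthogonality and vanishing of the vectors T^n e *)

Section SphericalTuple.
Variables (R : realType) (H : hilbert R) (m : nat) (T : 'I_m -> H -> H).
Local Notation C := R[i].
Hypothesis bcT : bc_tuple T.
Hypothesis sphT : spherical T.
Variable e : H.
Hypothesis e_neq0 : e <> 0.
Hypothesis kerE : defect_ker T = [set a *: e | a in [set: C]].

(** Inverting the rotation writes [T k (G x')] as a combination of the [G (T j x')], which are
    orthogonal to [G e] because [G] is unitary and [e] lies in the kernel. So [G e] is in the kernel
    too, and comparing norms gives modulus 1. *)
Lemma spherical_defect_eigen (U : 'M[C]_m) : U \is unitarymx ->
  exists G : H -> H, exists2 lam : C, `|lam| = 1 &
    [/\ unitary_op G, forall j x, G (T j x) = Defs.rot_tuple T U j (G x)
      & G e = lam *: e].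
Proof.
move=> Uu; have [G [Gu GT]] := sphT Uu; have [Glin Gip Gsur] := Gu.
have [lam _ Ge] : [set a *: e | a in [set: C]] (G e).
  rewrite -kerE => k x; have [x' <-] := Gsur x.
  have TG : T k (G x') = \sum_j conjc (U j k) *: G (T j x').
    under eq_bigr => j _ do rewrite GT /Defs.rot_tuple scaler_sumr.
    rewrite exchange_big /= (bigD1 k) //= [X in _ + X]big1 => [|l lk].
      rewrite addr0; under eq_bigr => j _ do rewrite scalerA.
      by rewrite -scaler_suml unitarymx_col // eqxx scale1r.
    under eq_bigr => j _ do rewrite scalerA.
    by rewrite -scaler_suml unitarymx_col // eq_sym (negPf lk) scale0r.
  rewrite TG hip_suml big1 // => j _; rewrite hipZl Gip.
  have : defect_ker T e by rewrite kerE; exists 1; rewrite ?scale1r.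
  by move=> ->; rewrite mulr0.
exists G, lam; last by split.
apply/eqP; rewrite -(@eqrXn2 _ 2) // expr1n -cabs2_norm; apply/eqP.
rewrite (_ : cabs2 lam = 1) //; apply: (mulIf (lt0r_neq0 (nsq_gt0 e_neq0))).
by rewrite mul1r -nsqZ Ge /nsq Gip.
Qed.

Lemma rot_foldr (U : 'M[C]_m) (G : H -> H) s x :
  (forall j x, G (T j x) = Defs.rot_tuple T U j (G x)) ->
  G (foldr T x s) = foldr (Defs.rot_tuple T U) (G x) s.
Proof. by move=> GT; elim: s => //= j s <-. Qed.

Lemma rot_foldrZ (U : 'M[C]_m) s (a : C) x :
  foldr (Defs.rot_tuple T U) (a *: x) s = a *: foldr (Defs.rot_tuple T U) x s.
Proof.
elim: s => //= j s ->; rewrite /Defs.rot_tuple scaler_sumr; apply: eq_bigr => k _.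
by rewrite (bcZ bcT) !scalerA mulrC.
Qed.

(* Rotating the j-th coordinate by z with z^(n_j - k_j) = -1 changes the sign
   of the inner product while Gamma(U) preserves it. *)
Lemma mpow_orthogonal n k : n != k -> hip (mpow T n e) (mpow T k e) = 0.
Proof.
suff lt_orth (n' k' : mindex m) j : (k' j < n' j)%N -> hip (mpow T n' e) (mpow T k' e) = 0.
  move=> nk; have /existsP [j] : [exists j, n j != k j].
    apply: contraNT nk; rewrite negb_exists => /forallP h.
    by apply/eqP/ffunP => j; have := h j; rewrite negbK => /eqP.
  rewrite neq_ltn => /orP[|/lt_orth//].
  by move=> /lt_orth; rewrite hip_conj => h; rewrite -[LHS]conjcK h conjc0.
move=> {n k} lt_kn; set d := (n' j - k' j)%N.
have d0 : (0 < d)%N by rewrite subn_gt0.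
pose z : C := d.-root (-1).
have zd : z ^+ d = -1 by rewrite rootCK.
have z1 : `|z| = 1.
  by apply/eqP; rewrite -(@eqrXn2 _ d) // expr1n -normrX zd normrN1.
pose c i := if i == j then z else 1.
have Uu : diag_mx (\row_i c i) \is unitarymx.
  by apply: diag_unitarymx => i; rewrite /c; case: ifP; rewrite ?normr1.
have [G [lam lam1 [[_ Gip _] GT Ge]]] := spherical_defect_eigen Uu.
(* Every letter [j] contributes a factor [z] and every other letter a factor 1. *)
have Gm n : G (mpow T n e) = (lam * z ^+ n j) *: mpow T n e.
  rewrite mpow_word (rot_foldr _ _ GT) Ge rot_foldrZ -scalerA; congr (_ *: _).
  have -> : n j = content (word n) j by rewrite content_word.
  rewrite ffunE.
  elim: (word n) => [|i s IH]; first by rewrite expr0 scale1r.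
  rewrite /= IH /Defs.rot_tuple (bigD1 i) //= big1 => [|l li]; last first.
    by rewrite !mxE eq_sym (negPf li) mulr0n scale0r.
  rewrite !mxE eqxx mulr1n addr0 (bcZ bcT) scalerA exprD /c.
  by case: (i == j) => /=; rewrite ?expr1 ?expr0.
have := Gip (mpow T n' e) (mpow T k' e).
rewrite !Gm hipZl hipZr mulrA.
have -> : lam * z ^+ n' j * conjc (lam * z ^+ k' j) = -1.
  have lamJ : lam * conjc lam = 1 by rewrite -sqr_normc lam1 expr1n.
  have zJ : z * conjc z = 1 by rewrite -sqr_normc z1 expr1n.
  rewrite rmorphM rmorphXn /= mulrACA lamJ mul1r -(subnK (ltnW lt_kn)) -/d.
  by rewrite exprD -mulrA -exprMn zJ expr1n mulr1 zd.
move=> /eqP; rewrite mulN1r -subr_eq0 -opprD oppr_eq0 -mulr2n mulrn_eq0 /=.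
by move=> /eqP.
Qed.

(** Equal contents give a squared norm, different contents give 0. Hence positive combinations of
    words cannot cancel. *)
Lemma foldr_hip_ge0 s t : 0 <= hip (foldr T e s) (foldr T e t).
Proof.
rewrite !(foldr_mpow bcT); have [->|st] := eqVneq (content s) (content t).
  exact: hip_ge0.
by rewrite mpow_orthogonal.
Qed.

(** The coefficient of the word [t] when the rotated product along [s] is multiplied out. *)
Definition word_coef (U : 'M[C]_m) s t : C := \prod_(p <- zip s t) U p.1 p.2.

Lemma word_coef_gt0 (U : 'M[C]_m) s t :
  (forall i k, i \in s -> k \in t -> 0 < U i k) -> 0 < word_coef U s t.
Proof.
elim: s t => [|i s IH] [|k t] h; rewrite /word_coef ?big_nil //=.
rewrite big_cons mulr_gt0 //; first by apply: h; rewrite inE eqxx.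
by apply: IH => i' k' i's k't; apply: h; rewrite inE ?i's ?k't orbT.
Qed.

Lemma rot_foldr_expand (U : 'M[C]_m) s x :
  foldr (Defs.rot_tuple T U) x s =
  \sum_(t <- all_words m (size s)) word_coef U s t *: foldr T x t.
Proof.
elim: s => [|i s IH]; first by rewrite /= big_seq1 /word_coef big_nil scale1r.
rewrite [RHS]/= big_allpairs_dep /= IH /Defs.rot_tuple big_enum /=.
apply: eq_bigr => k _; rewrite (bc_sum bcT) scaler_sumr; apply: eq_bigr => t _.
by rewrite (bcZ bcT) scalerA /word_coef /= big_cons.
Qed.

(** Applying Gamma(U) to the zero vector T^s e and expanding gives a vanishing combination of words.
    Paired with T^q e, only words with the content of [q] remain, with positive coefficients; every
    term is then 0, in particular the squared norm of T^q e. *)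
Lemma word_vanish_transfer (U : 'M[C]_m) s q : U \is unitarymx ->
  size q = size s ->
  (forall t, size t = size s -> content t = content q -> 0 < word_coef U s t) ->
  foldr T e s = 0 -> foldr T e q = 0.
Proof.
move=> Uu sq cpos s0; have [G [lam lam1 [[Glin Gip _] GT Ge]]] := spherical_defect_eigen Uu.
have lam0 : lam != 0 by rewrite -normr_eq0 lam1 oner_eq0.
have : G (foldr T e s) = 0.
  by rewrite s0; have := Glin (-1) 0 0; rewrite scaler0 addr0 scaleN1r addNr.
rewrite (rot_foldr _ _ GT) Ge rot_foldrZ => /eqP.
rewrite scaler_eq0 (negPf lam0) /= rot_foldr_expand => /eqP h.
have : hip (\sum_(t <- all_words m (size s)) word_coef U s t *: foldr T e t) (foldr T e q) = 0.
  by rewrite h hip0l.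
rewrite hip_suml big_seq => /eqP; rewrite psumr_eq0 => [/allP/(_ q)|t].
  rewrite mem_all_words sq eqxx => /(_ isT)/= /eqP; rewrite hipZl => /eqP.
  by rewrite mulf_eq0 gt_eqF ?cpos //= => /eqP/hip_eq0.
rewrite mem_all_words => /eqP ts; rewrite hipZl.
have [tq|tq] := eqVneq (content t) (content q).
  by rewrite mulr_ge0 ?foldr_hip_ge0 // ltW // cpos.
by rewrite !(foldr_mpow bcT) mpow_orthogonal ?mulr0.
Qed.

Lemma word_vanish_all s q :
  foldr T e s = 0 -> size q = size s -> foldr T e q = 0.
Proof.
move=> s0; case: s s0 => [/e_neq0//|j s s0 sq].
have [U Uu Upos] := unitarymx_positive_cross R j.
set N := size (j :: s) in sq.
(* Read backwards: vanishing passes from [s] to the power of [j] by positivity of column [j], then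
   from that power to [q] by positivity of row [j]. *)
apply: (@word_vanish_transfer U (nseq N j)); rewrite ?size_nseq //.
  move=> t _ _; apply: word_coef_gt0 => i k.
  by rewrite mem_nseq => /andP[_ /eqP->] _; case: (Upos k).
apply: (@word_vanish_transfer U (j :: s)); rewrite ?size_nseq //.
move=> t _ tc; apply: word_coef_gt0 => i k _ kt.
by rewrite (mem_content_nseq tc kt); case: (Upos i).
Qed.

End SphericalTuple.

(** * From a cyclic one-dimensional kernel to a weighted shift *)

Section SphericalShift.
Variables (R : realType) (H : hilbert R) (m : nat) (T : 'I_m -> H -> H).
Local Notation C := R[i].
Hypothesis infH : infinite_dim H.
Hypothesis bcT : bc_tuple T.
Hypothesis sphT : spherical T.
Hypothesis cycT : cyclic_for T (defect_ker T).
Variable e : H.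
Hypothesis e_neq0 : e <> 0.
Hypothesis kerE : defect_ker T = [set a *: e | a in [set: C]].

Let orth := mpow_orthogonal bcT sphT e_neq0 kerE.

Lemma cyclic_eq0 x : (forall n, hip (mpow T n e) x = 0) -> x = 0.
Proof.
move=> h; apply: (orthogonal_dense_eq0 cycT) => y [n [z [Dz ->]]].
have [a _ <-] : [set a *: e | a in [set: C]] z by rewrite -kerE.
by rewrite (mpowZ bcT) hipZl h mulr0.
Qed.

(* If one word of length N kills e, then all words of length at least N do, and
   the finitely many orthogonal vectors T^n e with all n_i < N span the space. *)
Lemma mpow_neq0 n : mpow T n e <> 0.
Proof.
rewrite mpow_word => s0; set N := size (word n).
have long t : (N <= size t)%N -> foldr T e t = 0.
  (* The last [N] letters act on [e] first and already send it to 0. *)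
  move=> Nt; rewrite -(cat_take_drop (size t - N) t) foldr_cat.
  rewrite (word_vanish_all bcT sphT e_neq0 kerE s0) ?(foldr0 bcT) //.
  by rewrite size_drop subKn.
pose idx (f : {ffun 'I_m -> 'I_N}) : mindex m := [ffun i => f i : nat].
have idxI : injective idx.
  by move=> f g /ffunP fg; apply/ffunP => i; apply: val_inj; have := fg i; rewrite !ffunE.
have far k : mpow T k e <> 0 -> exists f, k = idx f.
  move=> k0; have lt_k i : (k i < N)%N.
    rewrite ltnNge; apply/negP => Nk; apply: k0; rewrite mpow_word long //.
    apply: leq_trans Nk _; rewrite -{1}(content_word k) ffunE; exact: count_size.
  exists [ffun i => Ordinal (lt_k i)]; apply/ffunP => i.
  by rewrite !ffunE.
pose F := {ffun 'I_m -> 'I_N}.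
pose v (i : 'I_#|F|) := mpow T (idx (enum_val i)) e.
have [x] := infH v; apply.
(* Fourier coefficients for the orthogonal family [v]; where [v i = 0] the quotient takes the
   default value 0, a case treated separately below. *)
pose c i := hip x (v i) / hip (v i) (v i).
exists #|F|, v, c; split; first by move=> i; exists i.
apply/eqP; rewrite -subr_eq0; apply/eqP/cyclic_eq0 => k.
have [->|/far[f ->]] := pselect (mpow T k e = 0); first by rewrite hip0l.
have -> : mpow T (idx f) e = v (enum_rank f) by rewrite /v enum_rankK.
set i := enum_rank f; rewrite hip_conj.
suff -> : hip (x - \sum_(l < #|F|) c l *: v l) (v i) = 0 by rewrite conjc0.
rewrite hipBl hip_suml (bigD1 i) //= big1 => [|l li]; last first.
  rewrite hipZl [hip _ _]orth ?mulr0 //.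
  by apply: contraNneq li => /idxI/enum_val_inj->.
rewrite addr0 hipZl /c; have [->|vi0] := pselect (v i = 0).
  by rewrite !hip0r mulr0 subrr.
by rewrite divfK ?subrr //; apply/eqP => h; apply: vi0 (hip_eq0 h).
Qed.

Lemma spherical_weighted_shift : weighted_shift T.
Proof.
pose r n := hnorm (mpow T n e).
have r_gt0 n : 0 < r n by apply/hnorm_gt0/mpow_neq0.
have r_neq0 n : r n != 0 by rewrite gt_eqF.
(* Normalising T^n e turns [T j] into a shift whose weights are quotients of consecutive norms. *)
exists (fun n => (r n)^-1%:C%C *: mpow T n e), (fun j n => r (addeps n j) / r n).
split=> [|j n|j n]; last 2 first.
- by rewrite divr_gt0.
- rewrite (bcZ bcT) -(mpow_addeps bcT) scalerA -rmorphM /=.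
  by rewrite mulrAC mulfV // mul1r.
split=> [n k|x d d0].
  rewrite hipZl hipZr conjc_real; have [<-|nk] := eqVneq n k; last first.
    by rewrite orth // !mulr0.
  rewrite hip_nsq -hnorm_sqr -!rmorphM /= -/(r n) expr2.
  by rewrite [X in X%:C%C](_ : _ = 1) //; rewrite mulKf // mulVf.
have [y [[p [v [c [Sv ->]]]] xy]] := cycT x d0.
have /choice [k vk] : forall i, exists q : mindex m * C, v i = q.2 *: mpow T q.1 e.
  move=> i; have [n [z [Dz ->]]] := Sv i.
  have [a _ <-] : [set a *: e | a in [set: C]] z by rewrite -kerE.
  by exists (n, a); rewrite (mpowZ bcT).
exists (\sum_(i < p) c i *: v i); split => //.
exists p, (fun i => (r (k i).1)^-1%:C%C *: mpow T (k i).1 e).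
exists (fun i => c i * (k i).2 * (r (k i).1)%:C%C); split; first by move=> i; exists (k i).1.
apply: eq_bigr => i _; rewrite {1}vk !scalerA; congr (_ *: _).
by rewrite -mulrA -rmorphM /= mulfV // mulr1.
Qed.

End SphericalShift.

Lemma in_span_seq (R : realType) (H : hilbert R) (S : set H) (I : eqType)
    (s : seq I) (c : I -> R[i]) (v : I -> H) :
  (forall i, S (v i)) -> in_span S (\sum_(i <- s) c i *: v i).
Proof.
move=> Sv; exists (size s), (fun i => v (tnth (in_tuple s) i)).
exists (fun i => c (tnth (in_tuple s) i)); split => [i|]; first exact: Sv.
by rewrite big_tnth.
Qed.

(** * Finite parts and tails of the weighted power series norm *)

Section WeightedPowerSeries.
Variables (R : realType) (m : nat) (beta : mindex m -> R).
Local Notation C := R[i].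
Implicit Types (a : mindex m -> C) (n k : mindex m) (s : seq (mindex m)).

Lemma h2_term_ge0 a n : 0 <= cabs2 (a n) * beta n ^+ 2.
Proof. by rewrite mulr_ge0 ?cabs2_ge0 ?sqr_ge0. Qed.

(** The tail is the norm of the series with the entries in [s] set to 0, so facts on [h2norm2] apply
    to it again. *)
Lemma h2norm2_split a s : uniq s ->
  h2norm2 beta a = ((\sum_(n <- s) cabs2 (a n) * beta n ^+ 2)%:E +
    h2norm2 beta (fun n => if n \in s then 0%R else a n))%E.
Proof.
move=> us; rewrite {1}/h2norm2 (esumID [set` s]) => [|n _]; last first.
  by rewrite lee_fin h2_term_ge0.
rewrite !setTI; congr (_ + _)%E.
  rewrite esum_fset ; [|exact: finite_seq|by move=> n _; rewrite lee_fin h2_term_ge0].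
  by rewrite -fsbig_seq // sumEFin.
rewrite esum_mkcond; apply: eq_esum => n _.
have -> : (n \in ~` [set` s]) = (n \notin s) by rewrite in_setC mem_setE.
by case: ifPn => [/negPf->//|/negbNE->]; rewrite cabs2_0 mul0r.
Qed.

Lemma h2norm2_finsupp a s : uniq s -> (forall n, n \notin s -> a n = 0) ->
  h2norm2 beta a = (\sum_(n <- s) cabs2 (a n) * beta n ^+ 2)%:E.
Proof.
move=> us a0; rewrite (h2norm2_split a us) [X in (_ + X)%E]esum1 ?adde0 // => n _.
by case: ifPn => [_|/a0->]; rewrite cabs2_0 mul0r.
Qed.

Lemma h2norm2_ge_seq a s : uniq s ->
  ((\sum_(n <- s) cabs2 (a n) * beta n ^+ 2)%:E <= h2norm2 beta a)%E.
Proof.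
move=> us; rewrite (h2norm2_split a us) leeDl // esum_ge0 // => n _.
by rewrite lee_fin mulr_ge0 ?cabs2_ge0 ?sqr_ge0.
Qed.

Lemma h2norm2_le a (M : \bar R) :
  (forall s, uniq s -> ((\sum_(n <- s) cabs2 (a n) * beta n ^+ 2)%:E <= M)%E) ->
  (h2norm2 beta a <= M)%E.
Proof.
move=> hM; rewrite /h2norm2; apply: ge_ereal_sup => _ [X [finX _] <-].
by rewrite fsbig_finite //= sumEFin; apply: hM; exact: fset_uniq.
Qed.

(** The norm is a supremum of finite sums; a finite set whose sum comes within [d] of it leaves a
    tail below [d]. *)
Lemma h2norm2_tail a (d : R) : in_H2 beta a -> 0 < d ->
  exists2 s, uniq s &
    (h2norm2 beta (fun n => if n \in s then 0%R else a n) < d%:E)%E.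
Proof.
move=> fina d0.
have pos b : (0 <= h2norm2 beta b)%E.
  by apply: esum_ge0 => n _; rewrite lee_fin h2_term_ge0.
have afin : h2norm2 beta a \is a fin_num by rewrite ge0_fin_numE.
have : (h2norm2 beta a - d%:E < h2norm2 beta a)%E by rewrite lteBlDr // lteDl // lte_fin.
move=> /ereal_sup_gt [_ [X [finX _] <-]].
rewrite fsbig_finite //= sumEFin; set s := fset_set X => lt_s.
exists s; first exact: fset_uniq.
move: lt_s; rewrite (h2norm2_split a (fset_uniq s)).
set t := h2norm2 beta _; set S := (\sum_(n <- _) _).
have : (t <= h2norm2 beta a)%E.
  rewrite (h2norm2_split a (fset_uniq s)) leeDr // lee_fin sumr_ge0 // => n _.
  exact: h2_term_ge0.
move=> /le_lt_trans/(_ fina) tfin.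
have : t \is a fin_num by rewrite ge0_fin_numE ?pos.
move=> /fineK <-; rewrite -EFinD !lte_fin; lra.
Qed.

End WeightedPowerSeries.

(** * Multiplication by the coordinates as a weighted shift *)

Section MzShift.
Variables (R : realType) (H : hilbert R) (m : nat) (T : 'I_m -> H -> H).
Local Notation C := R[i].
Hypothesis bcT : bc_tuple T.
Variable beta : mindex m -> R.
Hypothesis beta_gt0 : forall n, 0 < beta n.

(** The monomial z^n as a coefficient family. *)
Definition delta n : mindex m -> C := fun k => (k == n)%:R.

Lemma in_H2_delta n : in_H2 beta (delta n).
Proof.
rewrite /in_H2 (@h2norm2_finsupp _ _ _ _ [:: n]) ?ltry // => k.
by rewrite inE /delta => /negPf->.
Qed.

Lemma Mz_delta j n : Mz j (delta n) = delta (addeps n j).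
Proof.
apply/funext => k; rewrite /Mz /delta; case: ifPn => kj.
  congr (nat_of_bool _)%:R; apply/eqP/eqP => [<-|->]; first by rewrite subepsK.
  by rewrite addepsK.
rewrite (_ : _ == _ = false) //; apply: contraNF kj => /eqP->.
exact: addeps_gt0.
Qed.

Lemma Mz_weighted_shift : unit_equiv_Mz T beta -> weighted_shift T.
Proof.
move=> [V [Vlin VH2 Vsur Vnorm VT]].
have V0 : V 0 = fun=> 0.
  by have := Vlin (-1) 0 0; rewrite scaler0 addr0 => ->; apply/funext => n; rewrite mulN1r addNr.
have VD x y n : V (x + y) n = V x n + V y n.
  by rewrite -[x]scale1r Vlin scale1r mul1r.
have VZ a x n : V (a *: x) n = a * V x n by rewrite -[X in V X]addr0 Vlin V0 addr0.
have VB x y n : V (x - y) n = V x n - V y n by rewrite VD -scaleN1r VZ mulN1r.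
have Vinj x y : V x = V y -> x = y.
  move=> Vxy; apply/eqP; rewrite -subr_eq0; apply/eqP/nsq_eq0.
  apply/eqP; rewrite -eqe Vnorm (@h2norm2_finsupp _ _ _ _ [::]) ?big_nil // => n _.
  by rewrite VB Vxy subrr.
have /choice [g Vg] : forall n, exists x, V x = delta n.
  by move=> n; apply/Vsur/in_H2_delta.
have nsq_seq x s : uniq s -> (forall n, n \notin s -> V x n = 0) ->
    nsq x = \sum_(n <- s) cabs2 (V x n) * beta n ^+ 2.
  by move=> us xs; apply/eqP; rewrite -eqe Vnorm (h2norm2_finsupp _ us xs).
have nsq_g n : nsq (g n) = beta n ^+ 2.
  rewrite (nsq_seq _ [:: n]) ?big_seq1 ?Vg /delta ?eqxx // => [|k].
    by rewrite (cabs2_real 1) expr1n mul1r.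
  by rewrite inE => /negPf->.
(* [unit_equiv_Mz] only preserves norms, so orthogonality comes from polarisation: the squared norm
   of [g n + a *: g k] is additive. *)
have Re_g n k a : n != k -> complex.Re (hip (g n) (a *: g k)) = 0.
  move=> nk; have := nsqD (g n) (a *: g k).
  rewrite nsqZ !nsq_g (nsq_seq _ [:: n; k]) /=; last 2 first.
  - by rewrite inE nk.
  - move=> l; rewrite !inE negb_or => /andP[ln lk].
    by rewrite VD VZ !Vg /delta (negPf ln) (negPf lk) mulr0 addr0.
  rewrite big_cons big_seq1 !VD !VZ !Vg /delta !eqxx (negPf nk) eq_sym (negPf nk).
  rewrite mulr0 addr0 add0r mulr1 (cabs2_real 1) expr1n mul1r.
  by rewrite -[LHS]addr0 => /addrI/esym/eqP; rewrite mulrn_eq0 => /eqP.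
have orth_g n k : n != k -> hip (g n) (g k) = 0.
  (* Scalar 1 kills the real part and scalar i the imaginary part. *)
  move=> nk; have := Re_g n k 1 nk; have := Re_g n k 'i%C nk.
  rewrite !hipZr; case: (hip (g n) (g k)) => p q /=.
  rewrite !mul0r !mulN1r !oppr0 !mul1r ?mul0r ?subr0 ?sub0r ?opprK => -> ->.
  by [].
have Tg j n : T j (g n) = g (addeps n j) by apply: Vinj; rewrite VT !Vg Mz_delta.
have b0 n : beta n != 0 by rewrite gt_eqF.
exists (fun n => (beta n)^-1%:C%C *: g n), (fun j n => beta (addeps n j) / beta n).
split=> [|j n|j n]; last 2 first.
- by rewrite divr_gt0.
- by rewrite (bcZ bcT) Tg scalerA -rmorphM /= mulrAC mulfV // mul1r.
split=> [n k|x d d0].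
  rewrite hipZl hipZr conjc_real; have [<-|nk] := eqVneq n k; last first.
    by rewrite orth_g // !mulr0.
  rewrite hip_nsq nsq_g -!rmorphM /= expr2.
  by rewrite [X in X%:C%C](_ : _ = 1) // mulKf // mulVf.
have d20 : 0 < d ^+ 2 by rewrite exprn_gt0.
have [s us tail] := h2norm2_tail (VH2 x) d20.
(* [V y] is the truncation of [V x] to [s], so the distance from [x] to [y] is governed by the
   tail. *)
pose y := \sum_(n <- s) (V x n * (beta n)%:C%C) *: ((beta n)^-1%:C%C *: g n).
exists y; split; first by apply: in_span_seq => n; exists n.
have Vy k : V y k = if k \in s then V x k else 0.
  have -> : V y k = \sum_(n <- s) V x n * (k == n)%:R.
    rewrite /y; elim: (s) => [|n r IH]; first by rewrite !big_nil V0.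
    rewrite !big_cons VD IH VZ VZ Vg -!mulrA; congr (_ * _ + _).
    by rewrite mulrA -rmorphM /= mulfV // mul1r.
  case: ifPn => ks.
    rewrite (bigD1_seq k) //= eqxx mulr1 big1 ?addr0 // => n nk.
    by rewrite eq_sym (negPf nk) mulr0.
  rewrite big_seq big1 // => n ns; rewrite (_ : k == n = false) ?mulr0 //.
  by apply: contraNF ks => /eqP->.
rewrite -(@ltr_pXn2r _ 2) ?nnegrE ?hnorm_ge0 ?ltW // hnorm_sqr -lte_fin Vnorm.
rewrite (_ : V (x - y) = fun n => if n \in s then 0 else V x n) //.
by apply/funext => n; rewrite VB Vy; case: ifP; rewrite ?subrr ?subr0.
Qed.

End MzShift.

(** * Bessel, Parseval and Riesz-Fischer *)

Section OrthonormalExpansion.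
Variables (R : realType) (K : hilbert R) (m : nat) (e : mindex m -> K).
Local Notation C := R[i].
Hypothesis onb : orthonormal_basis e.
Implicit Types (s : seq (mindex m)) (c : mindex m -> C).

Let ehip := onb_hip onb.

Lemma hip_onb_sum s c n : uniq s -> n \in s ->
  hip (\sum_(k <- s) c k *: e k) (e n) = c n.
Proof.
move=> us ns; rewrite hip_suml (bigD1_seq n) //= big1 => [|k kn].
  by rewrite addr0 hipZl ehip eqxx mulr1.
by rewrite hipZl ehip (negPf kn) mulr0.
Qed.

Lemma nsq_onb_sum s c : uniq s ->
  nsq (\sum_(k <- s) c k *: e k) = \sum_(k <- s) cabs2 (c k).
Proof.
elim: s => [|n s IH] /=; first by rewrite !big_nil /nsq hip0l.
case/andP=> ns us; rewrite !big_cons nsqD_orth ?IH //.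
  by rewrite nsqZ {1}/nsq ehip eqxx /= mulr1.
rewrite hipZl hip_sumr big_seq big1 ?mulr0 // => k ks.
by rewrite hipZr ehip (_ : n == k = false) ?mulr0 //; apply: contraNF ns => /eqP->.
Qed.

(** The residue is orthogonal to every combination of the [e n] with [n] in [s]; Pythagoras yields
    both the residue formula and best approximation. *)
Lemma bessel_residue x s c : uniq s ->
  nsq (x - \sum_(n <- s) hip x (e n) *: e n) =
  nsq x - \sum_(n <- s) cabs2 (hip x (e n)) /\
  nsq (x - \sum_(n <- s) hip x (e n) *: e n) <= nsq (x - \sum_(n <- s) c n *: e n).
Proof.
move=> us; set P := \sum_(n <- s) hip x (e n) *: e n.
have o c' : hip (x - P) (\sum_(n <- s) c' n *: e n) = 0.
  rewrite hip_sumr big_seq big1 // => n ns.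
  by rewrite hipZr hipBl hip_onb_sum // subrr mulr0.
split.
  by rewrite -(nsq_onb_sum _ us) -/P -[x in RHS](subrK P) (nsqD_orth (o _)) addrK.
have -> : x - \sum_(n <- s) c n *: e n =
    (x - P) + \sum_(n <- s) (hip x (e n) - c n) *: e n.
  under [in RHS]eq_bigr => n _ do rewrite scalerBl.
  by rewrite sumrB -/P addrA subrK.
by rewrite (nsqD_orth (o _)) lerDl nsq_ge0.
Qed.

Lemma onb_approx x (d : R) : 0 < d ->
  exists2 s, uniq s & nsq x < \sum_(n <- s) cabs2 (hip x (e n)) + d.
Proof.
move=> d0; have sd0 : 0 < Num.sqrt d by rewrite sqrtr_gt0.
have [y [[p [v [c [ve ->]]]] xy]] := onb_dense onb x sd0.
have /choice [k ek] : forall i, exists k, e k = v i.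
  by move=> i; have [k _ <-] := ve i; exists k.
pose s := undup (codom k); have us : uniq s := undup_uniq _.
(* The approximant may repeat basis vectors; [c'] collects the coefficients of equal ones. *)
exists s => //; pose c' n := \sum_(i | k i == n) c i.
have [E le_c'] := bessel_residue x c' us.
rewrite addrC -ltrBlDr -E; apply: le_lt_trans le_c' _.
rewrite (_ : \sum_(n <- s) _ = \sum_(i < p) c i *: v i).
  rewrite -hnorm_sqr -[d]sqr_sqrtr ?ltW //.
  by rewrite ltr_pXn2r ?nnegrE ?hnorm_ge0 ?ltW.
under eq_bigr => n _ do rewrite scaler_suml.
rewrite (exchange_big_dep xpredT) //=; apply: eq_bigr => i _.
rewrite big_mkcond (bigD1_seq (k i)) //= ?mem_undup ?codom_f // eqxx ek.
rewrite big1 ?addr0 // => n /negPf nk.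
by rewrite eq_sym nk.
Qed.

Variable beta : mindex m -> R.
Hypothesis beta_gt0 : forall n, 0 < beta n.

(** Dividing by [beta n] sends [e n] to the monomial z^n / beta_n, which has norm 1. *)
Definition onb_series x n : C := hip x (e n) / (beta n)%:C%C.

Lemma onb_series_term x n :
  cabs2 (onb_series x n) * beta n ^+ 2 = cabs2 (hip x (e n)).
Proof.
rewrite -cabs2_real -cabs2M /onb_series divfK //.
by apply/eqP => /complexI b0; have := beta_gt0 n; rewrite b0 ltxx.
Qed.

(** Bessel bounds every finite sum by [nsq x]; [onb_approx] gives the other inequality up to any
    [d > 0]. *)
Lemma onb_parseval x : (nsq x)%:E = h2norm2 beta (onb_series x).
Proof.
apply/eqP; rewrite eq_le; apply/andP; split; last first.
  apply: h2norm2_le => s us; rewrite lee_fin.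
  under eq_bigr => n _ do rewrite onb_series_term.
  by rewrite -subr_ge0; have [<- _] := bessel_residue x (fun=> 0) us; exact: nsq_ge0.
apply/lee_addgt0Pr => d d0; have [s us hs] := onb_approx x d0.
apply: (@le_trans _ _ (\sum_(n <- s) cabs2 (hip x (e n)) + d)%:E).
  by rewrite lee_fin ltW.
rewrite EFinD leeD2r //; under eq_bigr => n _ do rewrite -onb_series_term.
exact: h2norm2_ge_seq.
Qed.

(** Lists the multi-indices with code below [N], skipping numbers that encode none; these finite
    sets increase and exhaust all multi-indices. *)
Let upto N : seq (mindex m) := pmap pickle_inv (iota 0 N).

Let upto_uniq p q : uniq (pmap pickle_inv (iota p q) : seq (mindex m)).
Proof. exact: (pmap_uniq (@pickle_invK _)) (iota_uniq _ _). Qed.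

(** Squared distances between the partial sums [u] are differences of the bounded increasing
    sequence [b], so [u] is Cauchy; its limit has the prescribed coefficients because the inner
    product is continuous. *)
Lemma riesz_fischer (a : mindex m -> C) : in_H2 beta a ->
  exists x, onb_series x = a.
Proof.
move=> fina; pose c n := a n * (beta n)%:C%C.
have cE n : cabs2 (c n) = cabs2 (a n) * beta n ^+ 2 by rewrite cabs2M cabs2_real.
pose u N := \sum_(n <- upto N) c n *: e n.
pose b N := \sum_(n <- upto N) cabs2 (c n).
have ub p q : (q <= p)%N -> nsq (u p - u q) = b p - b q.
  move=> qp; have E : upto p = upto q ++ pmap pickle_inv (iota q (p - q)).
    by rewrite -pmap_cat -[X in iota X (p - q)]add0n -iotaD subnKC.
  by rewrite /u /b E !big_cat /= ![_ + \sum_(i <- pmap _ _) _ - _]addrAC !subrr !add0r nsq_onb_sum.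
have b_le p q : (q <= p)%N -> b q <= b p.
  by move=> qp; rewrite -subr_ge0 -ub // nsq_ge0.
have [M bM] : exists M, forall N, b N <= M.
  exists (fine (h2norm2 beta a)) => N; rewrite -lee_fin fineK; last first.
    rewrite ge0_fin_numE // esum_ge0 // => n _; rewrite lee_fin.
    exact: h2_term_ge0.
  apply: le_trans (h2norm2_ge_seq _ _ (upto_uniq 0 N)).
  by rewrite lee_fin /b; under eq_bigr => n _ do rewrite cE.
have sup_b : has_sup (range b).
  by split; [exists (b 0%N), 0%N | exists M => _ [N _ <-]].
have cauchy (d : R) : 0 < d -> exists N, forall p q, (N <= p)%N -> (N <= q)%N ->
    nsq (u p - u q) < d.
  move=> d0; have [_ [N _ <-] bN] := sup_adherent d0 sup_b.
  exists N; suff lt_d p q : (N <= q)%N -> (q <= p)%N -> nsq (u p - u q) < d.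
    move=> p q Np Nq; have [qp|/ltnW pq] := leqP q p; first exact: lt_d.
    by rewrite -[u p - u q]opprB nsqN lt_d.
  move=> Nq qp; rewrite ub // ltrBlDr.
  have bp : b p <= sup (range b) by apply: ub_le_sup; [exact: sup_b.2 | exists p].
  apply: le_lt_trans bp _; rewrite -ltrBlDl; apply: lt_le_trans (b_le _ _ Nq).
  by [].
have [l ul] : exists l : K, forall d : R, 0 < d -> exists N, forall n, (N <= n)%N ->
    hnorm (u n - l) < d.
  apply: (@hip_complete R K u) => d d0.
  have d20 : 0 < d ^+ 2 by rewrite exprn_gt0.
  have [N hN] := cauchy _ d20; exists N => p q Np Nq.
  rewrite -[ipnorm _ _]/(hnorm _) -(@ltr_pXn2r _ 2) ?nnegrE ?hnorm_ge0 ?ltW //.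
  by rewrite hnorm_sqr hN.
exists l; apply/funext => n.
have bn0 : (beta n)%:C%C != 0 :> C.
  by apply/eqP => /complexI h; have := beta_gt0 n; rewrite h ltxx.
apply: (mulIf bn0); rewrite /onb_series divfK // -/(c n).
apply/eqP; rewrite eq_sym -subr_eq0; apply/eqP/cabs2_eq0/le_anti.
rewrite cabs2_ge0 andbT; apply/ler_addgt0Pl => d d0; rewrite addr0.
have sd0 : 0 < Num.sqrt d by rewrite sqrtr_gt0.
(* [p] is late enough for [u p] to be close to [l], and exceeds the code of [n], so that [n] is
   listed in [upto p]. *)
have [N hN] := ul _ sd0; pose p := maxn N (choice.pickle n).+1.
have np : n \in upto p.
  rewrite /upto mem_pmap; apply/mapP; exists (choice.pickle n); rewrite ?pickleK_inv //.
  by rewrite mem_iota add0n leq_max ltnSn orbT.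
rewrite -(hip_onb_sum c (upto_uniq 0 p) np) -/(u p) -hipBl.
apply: le_trans (cauchy_schwarz _ _) _.
rewrite [nsq (e n)]/nsq ehip eqxx mulr1 -hnorm_sqr -[leRHS]sqr_sqrtr ?ltW //.
by rewrite ltr_pXn2r ?nnegrE ?hnorm_ge0 ?(ltW sd0) // hN // leq_maxl.
Qed.

End OrthonormalExpansion.

(** * From a weighted shift to multiplication by the coordinates *)

Section ShiftToMz.
Variables (R : realType) (K : hilbert R) (m : nat) (S : 'I_m -> K -> K).
Local Notation C := R[i].
Hypothesis bcS : bc_tuple S.

(* beta_n is determined by S^n e_0 = beta_n e_n. *)
Lemma weighted_shift_Mz : weighted_shift S ->
  exists2 beta : mindex m -> R, forall n, 0 < beta n & unit_equiv_Mz S beta.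
Proof.
move=> [e [w [onb w_gt0 Se]]].
have /choice [beta hbeta] : forall n, exists c : R,
    0 < c /\ mpow S n (e (mindex0 m)) = c%:C%C *: e n.
  by move=> n; have [c c0 cE] := shift_mpow bcS w_gt0 Se n; exists c.
have beta_gt0 n : 0 < beta n by case: (hbeta n).
(* Applying [T_j] once more multiplies the scalar by the next weight. *)
have beta_addeps j n : beta (addeps n j) = beta n * w j n.
  have [_ h1] := hbeta n; have [_ h2] := hbeta (addeps n j).
  move: h2; rewrite (mpow_addeps bcS) h1 (bcZ bcS) Se scalerA.
  move=> /(congr1 (fun x => hip x (e (addeps n j)))).
  by rewrite !hipZl (onb_hip onb) eqxx !mulr1 -rmorphM => /complexI.
exists beta => //; exists (onb_series e beta); split.
- move=> c x y; apply/funext => n; rewrite /onb_series hip_linear_l mulrDl.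
  by rewrite mulrA.
- by move=> x; rewrite /in_H2 -(onb_parseval onb) ?ltry.
- by move=> a /(riesz_fischer onb beta_gt0).
- by move=> x; rewrite -(onb_parseval onb).
move=> j x; apply/funext => n; rewrite /onb_series /Mz (shift_hip bcS onb w_gt0 Se).
case: ifP => [nj|_]; last by rewrite mul0r.
have -> : beta n = beta (subeps n j) * w j (subeps n j).
  by rewrite -beta_addeps subepsK.
have w0 : (w j (subeps n j))%:C%C != 0 :> C.
  by apply/eqP => /complexI h; have := w_gt0 j (subeps n j); rewrite h ltxx.
by rewrite rmorphM invfM [_ * hip _ _]mulrC mulrACA mulfV // mulr1.
Qed.

(** Every series in the space is some [V x], so the bound on [S j] carries over; it is squared
    because [h2norm2] is a squared norm. *)
Lemma unit_equiv_Mz_bounded (beta : mindex m -> R) :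
  unit_equiv_Mz S beta -> Mz_bounded beta.
Proof.
move=> [V [_ _ Vsur Vnorm VS]] j; have [M M0 hM] := bc_hnorm bcS j.
exists (M ^+ 2) => a /Vsur [x <-].
rewrite -VS -!Vnorm -EFinM lee_fin -!/(nsq _) -!hnorm_sqr -exprMn.
by rewrite ler_pXn2r ?nnegrE ?mulr_ge0 ?hnorm_ge0.
Qed.

End ShiftToMz.

(** * Transport along unitary equivalence and the cycle of implications *)

Lemma unit_equiv_Mz_trans (R : realType) (H K : hilbert R) (m : nat)
    (T : 'I_m -> H -> H) (S : 'I_m -> K -> K) (beta : mindex m -> R) :
  unit_equiv T S -> unit_equiv_Mz S beta -> unit_equiv_Mz T beta.
Proof.
move=> [V [Vlin Vip Vsur VT]] [W [Wlin WH2 Wsur Wnorm WS]].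
exists (W \o V); split => /=.
- by move=> c x y; rewrite Vlin Wlin.
- by move=> x; apply: WH2.
- by move=> a /Wsur [z <-]; have [x <-] := Vsur z; exists x.
- by move=> x; rewrite -Vip Wnorm.
- by move=> j x; rewrite VT WS.
Qed.

Theorem theorem2p5 (R : realType) (H : hilbert R) (m : nat)
    (T : 'I_m -> H -> H) :
  infinite_dim H -> bc_tuple T -> spherical T ->
  [<-> one_dim (defect_ker T) /\ cyclic_for T (defect_ker T);
       exists (K : hilbert R) (S : 'I_m -> K -> K),
         [/\ bc_tuple S, weighted_shift S & unit_equiv T S];
       exists beta : mindex m -> R,
         [/\ forall n, 0 < beta n, Mz_bounded beta & unit_equiv_Mz T beta]].
Proof.
move=> infH bcT sphT; tfae.
- move=> [[e [e_neq0 kerE]] cycT]; exists H, T; split => //.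
    exact: spherical_weighted_shift kerE.
  by exists id; split => // z; exists z.
- move=> [K [S [bcS shS eqTS]]].
  have [beta beta_gt0 SMz] := weighted_shift_Mz bcS shS.
  exists beta; split => //; first exact: unit_equiv_Mz_bounded SMz.
  exact: unit_equiv_Mz_trans eqTS SMz.
(* Pulling the normalised monomials back to [H] makes [T] itself a weighted shift, so the kernel
   computation applies to it directly. *)
- move=> [beta [beta_gt0 _ /(Mz_weighted_shift bcT beta_gt0)]].
  move=> [e [w [onb w_gt0 Te]]].
  exact: (shift_cyclic_defect_ker bcT onb w_gt0 Te).
Qed.
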